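(* A laminar matroid $M$ has a unique canonical presentation $(E,\mathcal{A},c)$. Indeed, when $M$ is loopless, $\mathcal{A}=\{\mathrm{cl}(C): C \text{ is a circuit of } M\}$ and $c(\mathrm{cl}(C))=r(C)=|C|-1$ for every circuit $C$ of $M$.
   Context: All matroids are finite; $\mathrm{cl}$ and $r$ denote closure and rank in $M$. A family $\mathcal{A}$ of subsets of a finite set $E$ is laminar if, for all $A,B\in\mathcal{A}$ with $A\cap B\neq\emptyset$, either $A\subseteq B$ or $B\subseteq A$. Given a laminar family $\mathcal{A}$ of subsets of $E$ and a capacity function $c:\mathcal{A}\to\mathbb{Z}_{\ge 0}$, $M(E,\mathcal{A},c)$ is the matroid on $E$ whose independent sets are exactly the sets $I\subseteq E$ with $|I\cap A|\le c(A)$ for all $A\in\mathcal{A}$. A matroid is laminar if it is isomorphic to some $M(E,\mathcal{A},c)$. If $M=M(E,\mathcal{A},c)$, then $(E,\mathcal{A},c)$ is called a presentation for $M$. A set $A\in\mathcal{A}$ is essential if $M(E,\mathcal{A},c)\neq M(E,\mathcal{A}-\{A\},c|_{\mathcal{A}-\{A\}})$. When $M$ has no loops, a presentation $(E,\mathcal{A},c)$ for $M$ is canonical if every $A\in\mathcal{A}$ is essential. When $M$ has a loop, a presentation for $M$ is canonical if it can be written as $(E,\mathcal{A}\cup\{A_0\},c)$, where $A_0=\mathrm{cl}(\emptyset)$ and $(E-A_0,\mathcal{A},c|_{\mathcal{A}})$ is a canonical presentation of the loopless matroid $M\backslash A_0$. *)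

(* Defs.v *)
From mathcomp Require Import all_boot.

Set Implicit Arguments.
Unset Strict Implicit.
Unset Printing Implicit Defensive.

Definition matroid_axioms (T : finType) (E : {set T}) (F : {set {set T}}) : bool :=
  [&& F \subset powerset E,
      set0 \in F,
      [forall I in F, powerset I \subset F]
    & [forall I in F, forall J in F,
         (#|I| < #|J|) ==> [exists x in J :\: I, x |: I \in F]]].

(* The axioms are boolean, hence proof irrelevant, so [=] on [matroid T] is
   equality of ground sets and of families of independent sets ([matroid_eq]). *)
Record matroid (T : finType) := Matroid {
  ground : {set T};
  indep : {set {set T}};
  matroidP : matroid_axioms ground indep
}.

Lemma matroid_eq (T : finType) (M N : matroid T) :
  ground M = ground N -> indep M = indep N -> M = N.
Proof.
case: M N => [E F h] [E' F' h'] /= eqE eqF; subst E' F'.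
by rewrite (bool_irrelevance h h').
Qed.

Section MatroidNotions.

Variables (T : finType) (M : matroid T).

Definition circuit (C : {set T}) : bool :=
  minset [pred X : {set T} | (X \subset ground M) && (X \notin indep M)] C.

Definition rank (X : {set T}) : nat :=
  \max_(I in indep M | I \subset X) #|I|.

Definition cl (X : {set T}) : {set T} :=
  [set x in ground M | rank (x |: X) == rank X].

Definition loop (x : T) : bool := circuit [set x].

Definition loopless : bool := [forall x, ~~ loop x].

Lemma delete_axioms (D : {set T}) :
  matroid_axioms (ground M :\: D)
                 [set I in indep M | I \subset ground M :\: D].
Proof.
have /and4P[sFE F0 /forall_inP hered /forall_inP aug] := matroidP M.
apply/and4P; split.
- by apply/subsetP => I; rewrite !inE => /andP[].
- by rewrite inE F0 sub0set.
- apply/forall_inP => I; rewrite inE => /andP[FI sI].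
  apply/subsetP => J; rewrite !inE => sJI.
  rewrite (subset_trans sJI sI) andbT.
  by apply: (subsetP (hered I FI)); rewrite inE.
- apply/forall_inP => I; rewrite inE => /andP[FI sI].
  apply/forall_inP => J; rewrite inE => /andP[FJ sJ].
  apply/implyP => ltIJ.
  have /forall_inP/(_ J FJ)/implyP/(_ ltIJ)/exists_inP[x xJI FxI] := aug I FI.
  apply/exists_inP; exists x => //; rewrite inE FxI subUset sI andbT sub1set.
  by apply: (subsetP sJ); move: xJI; rewrite inE => /andP[].
Qed.

Definition delete (D : {set T}) : matroid T := Matroid (delete_axioms D).

End MatroidNotions.

(* The bijection of ground sets is the restriction of a total map [T -> T'].
   Such a map always exists unless [T'] is empty and [T] is not, which is harmless
   where [T'] is existentially quantified, as in [is_laminar]. *)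
Definition isomorphic (T T' : finType) (M : matroid T) (N : matroid T') : Prop :=
  exists f : T -> T',
    [/\ {in ground M &, injective f},
        f @: ground M = ground N
      & forall I : {set T}, I \subset ground M ->
          (I \in indep M) = (f @: I \in indep N)].

Definition laminar (T : finType) (E : {set T}) (A : {set {set T}}) : bool :=
  (A \subset powerset E) &&
  [forall X in A, forall Y in A,
     (X :&: Y != set0) ==> (X \subset Y) || (Y \subset X)].

Definition laminar_indep (T : finType) (E : {set T}) (A : {set {set T}})
    (c : {set T} -> nat) : {set {set T}} :=
  [set I in powerset E | [forall X in A, #|I :&: X| <= c X]].

Lemma laminar_axioms (T : finType) (E : {set T}) (A : {set {set T}})
    (c : {set T} -> nat) :
  laminar E A -> matroid_axioms E (laminar_indep E A c).
Proof.
move=> /andP[sAE /forall_inP lam]; apply/and4P; split.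
- by apply/subsetP => I; rewrite inE => /andP[].
- rewrite !inE sub0set; apply/forall_inP => X _.
  by rewrite set0I cards0.
- apply/forall_inP => I; rewrite !inE => /andP[sIE /forall_inP cI].
  apply/subsetP => J; rewrite !inE => sJI.
  rewrite (subset_trans sJI sIE); apply/forall_inP => X AX.
  by apply: leq_trans (cI X AX); rewrite subset_leq_card // setSI.
apply/forall_inP => I; rewrite !inE => /andP[sIE /forall_inP cI].
apply/forall_inP => J; rewrite !inE => /andP[sJE /forall_inP cJ].
apply/implyP; apply: contraLR => /exists_inPn noaug; rewrite -leqNgt.
pose tight := [set X in A | #|I :&: X| == c X].
pose P := [set X in tight | [forall Y in tight, (X \subset Y) ==> (X == Y)]].
have AP X : X \in P -> X \in A by rewrite !inE => /andP[/andP[]].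
have tP X : X \in P -> #|I :&: X| = c X by rewrite !inE => /andP[/andP[_ /eqP]].
have maxP X Y : X \in P -> Y \in tight -> X \subset Y -> X = Y.
  by rewrite inE => /andP[_ /forall_inP mX] tY sXY; apply/eqP/(implyP (mX Y tY)).
have Ptight X : X \in P -> X \in tight by rewrite inE => /andP[].
have trivP : trivIset P.
  apply/trivIsetP => X Y PX PY; apply: contraR.
  rewrite -setI_eq0 => nXY.
  have /forall_inP/(_ Y (AP Y PY))/implyP/(_ nXY)/orP[s|s] := lam X (AP X PX).
  - by rewrite (maxP X Y PX (Ptight Y PY) s).
  - by rewrite (maxP Y X PY (Ptight X PX) s).
have sJIP : J :\: I \subset cover P.
  apply/subsetP => x xJI.
  have [X tX xX] : exists2 X, X \in tight & x \in X.
    have := noaug x xJI.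
    have /andP[xI xJ] : (x \notin I) && (x \in J) by rewrite -in_setD.
    rewrite !inE subUset sub1set (subsetP sJE) // sIE /=.
    case/forall_inPn => X AX; rewrite -ltnNge => lt.
    have xX : x \in X.
      apply: contraLR lt => xX; rewrite -leqNgt.
      suff -> : (x |: I) :&: X = I :&: X by exact: cI.
      apply/setP => y; rewrite !inE.
      by case: eqP => // ->; rewrite (negbTE xX) !andbF.
    exists X => //; rewrite inE AX eqn_leq (cI X AX) /=.
    move: lt; rewrite setIUl (setIidPl _) ?sub1set // => lt.
    by rewrite -ltnS (leq_trans lt) // (leq_trans (leq_card_setU _ _)) ?cards1.
  have [Y /maxsetP[/andP[tY xY] mY] sXY] :
      {Y | maxset [pred Z : {set T} | (Z \in tight) && (x \in Z)] Y & X \subset Y}.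
    by apply: maxset_exists; rewrite /= tX.
  apply/bigcupP; exists Y => //; rewrite inE tY; apply/forall_inP => Z tZ.
  apply/implyP => sYZ; rewrite eq_sym; apply/eqP/mY => //=.
  by rewrite tZ (subsetP sYZ).
have cardP (K : {set T}) : #|K :&: cover P| = \sum_(X in P) #|K :&: X|.
  rewrite -sum1_card (eq_bigl (fun x => (x \in cover P) && (x \in K))); last first.
    by move=> x; rewrite inE andbC.
  rewrite (big_trivIset_cond _ _) //=; apply: eq_bigr => X _.
  by rewrite -sum1_card; apply: eq_bigl => x; rewrite inE andbC.
rewrite -(cardsID (cover P) J) -(cardsID (cover P) I); apply: leq_add.
  rewrite !cardP; apply: leq_sum => X PX.
  by rewrite (tP X PX) cJ // AP.
apply/subset_leq_card/subsetP => x; rewrite !inE => /andP[xP xJ].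
rewrite xP /=; apply: contraR xP => xI.
by apply: (subsetP sJIP); rewrite inE xI.
Qed.

(* [c] is a function on all of [{set T}], of which only the restriction to [A]
   matters. *)
Definition laminar_matroid (T : finType) (E : {set T}) (A : {set {set T}})
    (c : {set T} -> nat) (lamA : laminar E A) : matroid T :=
  Matroid (laminar_axioms c lamA).

Definition is_laminar (T : finType) (M : matroid T) : Prop :=
  exists (T' : finType) (E : {set T'}) (A : {set {set T'}})
         (c : {set T'} -> nat) (lamA : laminar E A),
    isomorphic M (laminar_matroid c lamA).

Definition presentation (T : finType) (M : matroid T) (E : {set T})
    (A : {set {set T}}) (c : {set T} -> nat) : Prop :=
  exists lamA : laminar E A, M = laminar_matroid c lamA.

Lemma laminarD1 (T : finType) (E : {set T}) (A : {set {set T}}) (X : {set T}) :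
  laminar E A -> laminar E (A :\ X).
Proof.
move=> /andP[sAE /forall_inP lam]; apply/andP; split.
  by apply: subset_trans sAE; exact: subD1set.
apply/forall_inP => Y /setD1P[_ AY]; apply/forall_inP => Z /setD1P[_ AZ].
by have /forall_inP/(_ Z AZ) := lam Y AY.
Qed.

Definition essential (T : finType) (E : {set T}) (A : {set {set T}})
    (c : {set T} -> nat) (lamA : laminar E A) (X : {set T}) : Prop :=
  laminar_matroid c lamA <> laminar_matroid c (laminarD1 X lamA).

Definition canonical_loopless (T : finType) (M : matroid T) (E : {set T})
    (A : {set {set T}}) (c : {set T} -> nat) : Prop :=
  exists lamA : laminar E A,
    M = laminar_matroid c lamA /\
    (forall X, X \in A -> essential c lamA X).

(* In the loop case the capacities used on the deletion are the restriction of
   the same [c], and [A'] necessarily consists of subsets of [E :\: cl M set0]. *)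
Definition canonical (T : finType) (M : matroid T) (E : {set T})
    (A : {set {set T}}) (c : {set T} -> nat) : Prop :=
  if loopless M then canonical_loopless M E A c
  else
    presentation M E A c /\
    exists A' : {set {set T}},
      A = cl M set0 |: A' /\
      canonical_loopless (delete M (cl M set0)) (E :\: cl M set0) A' c.

(* Main.v *)
Require Import Defs.
From mathcomp Require Import all_boot.

Set Implicit Arguments.
Unset Strict Implicit.
Unset Printing Implicit Defensive.

(**
If every member of a loopless laminar presentation is essential and a circuit
[C] exceeds the capacity of a member [X], then [C] is contained in [X] and
[#|C| = c X + 1], so [X] is contained in [cl C]. A point [x] of [cl C]
outside [X] would lie in a member [Y] overfull for [C - y + x]; looplessness
makes [Y] meet [X], so [X] is properly contained in [Y] while [c Y <= c X], and
[X] would be redundant. Thus [X = cl C]. Conversely, a set witnessing that [X]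
is essential contains a circuit of size [c X + 1] inside [X].

For existence, the capacities of any laminar presentation can be replaced by
ranks; the rank capacities are stable under isomorphism, deletion and passing
to an inclusion-minimal family.
*)

(** * Rank, closure, loops and circuits *)

Section MatroidBasics.

Variables (T : finType) (M : matroid T).
Implicit Types (I J X C : {set T}) (x : T).

Lemma indep_ground I : I \in indep M -> I \subset ground M.
Proof.
have /and4P[/subsetP sub _ _ _] := matroidP M.
by move=> /sub; rewrite inE.
Qed.

Lemma indep0 : set0 \in indep M.
Proof. by have /and4P[] := matroidP M. Qed.

Lemma indepS I J : J \in indep M -> I \subset J -> I \in indep M.
Proof.
have /and4P[_ _ /forall_inP her _] := matroidP M.
by move=> /her/subsetP sub sIJ; apply: sub; rewrite inE.
Qed.

Lemma leq_rank I X : I \in indep M -> I \subset X -> #|I| <= rank M X.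
Proof.
by move=> FI sIX; rewrite /rank (bigmax_sup I) ?FI.
Qed.

Lemma rank_leqP X n :
  reflect (forall I, I \in indep M -> I \subset X -> #|I| <= n)
          (rank M X <= n).
Proof.
apply: (iffP idP) => [h I FI sIX|h]; first exact: leq_trans (leq_rank FI sIX) h.
by apply/bigmax_leqP => I /andP[]; exact: h.
Qed.

Lemma rankS (X Y : {set T}) : X \subset Y -> rank M X <= rank M Y.
Proof.
move=> sXY; apply/rank_leqP => I FI sIX.
by apply: leq_rank => //; apply: subset_trans sXY.
Qed.

Lemma rank0 : rank M set0 = 0.
Proof.
apply/eqP; rewrite -leqn0; apply/rank_leqP => I _.
by rewrite subset0 => /eqP->; rewrite cards0.
Qed.

Lemma mem_cl0 x : (x \in cl M set0) = (x \in ground M) && ([set x] \notin indep M).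
Proof.
rewrite inE setU0 rank0; case: (x \in ground M) => //=; apply/idP/idP.
  by apply: contraL => Fx; rewrite -lt0n -(cards1 x) leq_rank.
move=> nFx; rewrite -leqn0; apply/rank_leqP => I FI.
by rewrite subset1 => /orP[] /eqP eI; rewrite eI ?cards0 // -eI FI in nFx *.
Qed.

Lemma loop_cl0 x : loop M x = (x \in cl M set0).
Proof.
rewrite mem_cl0 /loop /circuit; apply/minsetP/idP => [[/=]|/andP[gx nFx]].
  by rewrite sub1set.
split=> [|X /=]; first by rewrite /= sub1set gx.
by rewrite subset1 => /andP[_ nFX] /orP[] /eqP eX //; rewrite eX indep0 in nFX.
Qed.

Lemma rank_cl0 : rank M (cl M set0) = 0.
Proof.
apply/eqP; rewrite -leqn0; apply/rank_leqP => I FI /subsetP sI.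
rewrite leqn0 cards_eq0; apply/set0Pn => -[x xI].
by have := sI x xI; rewrite mem_cl0 (indepS FI) ?andbF ?sub1set.
Qed.

Lemma loopless_indep1 x : loopless M -> x \in ground M -> [set x] \in indep M.
Proof.
move=> /forallP/(_ x); rewrite loop_cl0 mem_cl0 => + gx.
by rewrite gx negbK.
Qed.

Lemma circuitP C :
  reflect [/\ C \subset ground M, C \notin indep M
            & forall y, y \in C -> C :\ y \in indep M]
          (circuit M C).
Proof.
apply: (iffP minsetP) => [[/andP[gC nFC] minC]|[gC nFC h]].
  split=> // y yC; apply/negPn/negP => nF.
  have /setP/(_ y) : C :\ y = C.
    by apply: minC; rewrite ?subD1set //= nF (subset_trans (subD1set _ _)).
  by rewrite !inE eqxx yC.
split=> [|X /andP[_ nFX] sXC]; first by rewrite /= gC.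
apply/eqP; rewrite eqEsubset sXC; apply/subsetP => y yC.
by apply: contraR nFX => yX; apply: indepS (h y yC) _; rewrite subsetD1 sXC.
Qed.

Lemma circuit_neq0 C : circuit M C -> exists y, y \in C.
Proof.
by case/circuitP=> _ nFC _; apply/set0Pn; apply: contra nFC => /eqP->; exact: indep0.
Qed.

Lemma rank_circuit C : circuit M C -> rank M C = #|C|.-1.
Proof.
move=> cC; have [y yC] := circuit_neq0 cC; have /circuitP[_ nFC h] := cC.
apply/eqP; rewrite eqn_leq; apply/andP; split; last first.
  by rewrite (cardsD1 y C) yC add1n /= leq_rank ?h ?subD1set.
apply/rank_leqP => I FI sIC; rewrite -ltnS prednK; last first.
  by rewrite card_gt0; apply/set0Pn; exists y.
apply: proper_card; rewrite properEneq sIC andbT.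
by apply: contraNneq nFC => <-.
Qed.

End MatroidBasics.

Lemma delete_cl0_loopless (T : finType) (M : matroid T) :
  loopless (delete M (cl M set0)).
Proof.
apply/forallP => x; rewrite loop_cl0 mem_cl0 /= in_setD mem_cl0.
have [gx|] := boolP (x \in ground M); last by rewrite andbF.
have [Fx|//] := boolP ([set x] \in indep M); rewrite negbK inE Fx /=.
by rewrite sub1set in_setD gx mem_cl0 Fx andbF.
Qed.

(** * Essential members and closures of circuits *)

Lemma laminar_indepP (T : finType) (E : {set T}) (A : {set {set T}}) c (I : {set T}) :
  reflect (I \subset E /\ forall X, X \in A -> #|I :&: X| <= c X)
          (I \in laminar_indep E A c).
Proof.
by rewrite !inE; apply: (iffP andP) => -[? /forall_inP].
Qed.

Section LaminarPresentation.

Variables (T : finType) (M : matroid T) (E : {set T}) (A : {set {set T}}).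
Variable c : {set T} -> nat.
Implicit Types (I X Y C : {set T}).

Lemma presentationP :
  presentation M E A c <->
  [/\ ground M = E, laminar E A & indep M = laminar_indep E A c].
Proof.
split=> [[lamA ->] //|[gM lamA iM]].
by exists lamA; apply: matroid_eq.
Qed.

(** Since [matroid_eq] reduces equality of matroids to equality of families of sets, essentiality
    can be tested without the proofs of laminarity that the records carry. *)
Lemma canonical_looplessP :
  canonical_loopless M E A c <->
  presentation M E A c /\
  (forall X, X \in A -> laminar_indep E (A :\ X) c != indep M).
Proof.
split=> [[lamA [eM ess]]|[[lamA eM] ess]].
  split=> [|X AX]; first by exists lamA.
  by apply/eqP => eF; apply: (ess X AX); apply: matroid_eq; rewrite //= eF eM.
exists lamA; split=> // X /ess/eqP nF eF; apply: nF.
by rewrite eM eF.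
Qed.

(** Dropping a constraint can only enlarge the family of independent sets, so an essential [X] comes
    with a newly independent set, which violates the bound at [X] and no other. *)
Lemma canonical_essential X :
  canonical_loopless M E A c -> X \in A ->
  exists I, [/\ I \subset E, c X < #|I :&: X|
    & forall Y, Y \in A -> Y != X -> #|I :&: Y| <= c Y].
Proof.
move=> /canonical_looplessP[/presentationP[_ _ iM] ess] AX.
have sF : indep M \subset laminar_indep E (A :\ X) c.
  apply/subsetP => I; rewrite iM => /laminar_indepP[sI cI].
  by apply/laminar_indepP; split=> // Y /setD1P[_ /cI].
have /subsetPn[I /laminar_indepP[sI cI]] :
    ~~ (laminar_indep E (A :\ X) c \subset indep M).
  by apply: contra (ess X AX) => sF'; rewrite eqEsubset sF' sF.
have cI' Y : Y \in A -> Y != X -> #|I :&: Y| <= c Y.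
  by move=> AY nYX; apply: cI; rewrite !inE nYX.
move=> nFI; exists I; split=> //; rewrite ltnNge; apply: contra nFI => cX.
rewrite iM; apply/laminar_indepP; split=> // Y AY.
by have [->//|] := eqVneq Y X; exact: cI'.
Qed.

(** Removing a point of [C] outside [X] would leave [C :&: X] unchanged, hence still too large,
    although the result is independent. Removing a point of [C] inside [X] then bounds [#|C|] from
    above. *)
Lemma circuit_overfull X C :
  presentation M E A c -> X \in A -> circuit M C -> c X < #|C :&: X| ->
  C \subset X /\ #|C| = (c X).+1.
Proof.
move=> /presentationP[gM _ iM] AX /circuitP[sC nFC h] ltX.
have sCX : C \subset X.
  apply/subsetP => y yC; apply: contraLR ltX => yX; rewrite -leqNgt.
  have := h y yC; rewrite iM => /laminar_indepP[_ /(_ X AX)].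
  apply: leq_trans; apply/subset_leq_card/subsetP => z; rewrite !inE.
  by case: eqP => // -> /andP[_ zX]; rewrite zX in yX.
split=> //; move: ltX; rewrite (setIidPl sCX) => ltX.
have [y yC] : exists y, y \in C.
  by apply/set0Pn; rewrite -card_gt0; apply: leq_ltn_trans ltX.
apply/eqP; rewrite eqn_leq ltX andbT (cardsD1 y) yC ltnS.
have := h y yC; rewrite iM => /laminar_indepP[_ /(_ X AX)].
by rewrite (setIidPl _) // (subset_trans (subD1set _ _)).
Qed.

Lemma canonical_cl_circuit X C :
  loopless M -> canonical_loopless M E A c -> X \in A -> circuit M C ->
  c X < #|C :&: X| -> cl M C = X.
Proof.
move=> llM canA AX cC ltX.
have presA : presentation M E A c by case/canonical_looplessP: canA.
have [sCX cardC] := circuit_overfull presA AX cC ltX.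
have rC : rank M C = c X by rewrite rank_circuit // cardC.
have /circuitP[sC nFC h] := cC; have [gM lamA iM] := (presentationP.1 presA).
have [sAE /forall_inP lam] := andP lamA.
(* This gives the inclusion of [X] in [cl M C]: for [x] in [X], the rank of [x |: C] lies between
   [rank M C = c X] and [rank M X]. *)
have rX : rank M X <= c X.
  apply/rank_leqP => I; rewrite iM => /laminar_indepP[_ /(_ X AX)] + sIX.
  by rewrite (setIidPl sIX).
apply/setP => x; rewrite inE; apply/idP/idP => [/andP[gx /eqP rxC]|xX]; last first.
  rewrite gM; have := subsetP sAE X AX; rewrite inE => /subsetP-> //=.
  rewrite eqn_leq [rank M C <= _]rankS ?subsetUr // andbT rC.
  by apply: leq_trans rX; rewrite rankS // subUset sub1set xX.
apply: contraT => xX; have xC : x \notin C by apply: contra xX => /(subsetP sCX).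
have [y yC] := circuit_neq0 cC.
have cardD : #|C :\ y| = c X by move: cardC; rewrite (cardsD1 y) yC => -[].
have xD : x \notin C :\ y by rewrite inE (negbTE xC) andbF.
(* Otherwise [x |: C] would contain an independent set of size [c X + 1], while its rank is that of
   [C], namely [c X]. *)
have nF : x |: (C :\ y) \notin indep M.
  apply: contraL (leqnn (c X).+1) => Fx; rewrite -ltnNge ltnS.
  rewrite -[X in _ <= X]rC -rxC; apply: leq_trans (leq_rank Fx _).
    by rewrite cardsU1 xD cardD.
  by rewrite setUS // subD1set.
have [Y AY ltY] : exists2 Y, Y \in A & c Y < #|(x |: (C :\ y)) :&: Y|.
  apply/exists_inP; apply: contraR nF => /exists_inPn nY.
  rewrite iM; apply/laminar_indepP; split=> [|Y /nY]; last by rewrite -leqNgt.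
  by rewrite -gM subUset sub1set gx (subset_trans (subD1set _ _)).
(* [C :\ y] is independent, so only [x] can push the set over the capacity of [Y]. *)
have xY : x \in Y.
  apply: contraLR ltY => xY; rewrite -leqNgt.
  have := h y yC; rewrite iM => /laminar_indepP[_ /(_ Y AY)].
  apply: leq_trans; apply/subset_leq_card/subsetP => z; rewrite !inE.
  by case: eqP => [->|//]; rewrite (negbTE xY) !andbF.
have cY : 0 < c Y.
  have := loopless_indep1 llM gx; rewrite iM => /laminar_indepP[_ /(_ Y AY)].
  by rewrite (setIidPl _) ?cards1 ?sub1set.
(* If [Y] missed [X], it would also miss [C] and meet the set in [x] alone, which a positive
   capacity allows. *)
have nXY : X :&: Y != set0.
  apply: contraTneq ltY => dXY; rewrite -leqNgt.
  apply: leq_trans cY; rewrite -(cards1 x); apply/subset_leq_card/subsetP => z.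
  rewrite !inE => /andP[/orP[//|/andP[_ zC]] zY].
  by have := in_set0 z; rewrite -dXY inE (subsetP sCX) ?zY.
have sXY : X \subset Y.
  have /forall_inP/(_ Y AY)/implyP/(_ nXY)/orP[//|/subsetP/(_ x xY)] := lam X AX.
  by rewrite (negbTE xX).
have leYX : c Y <= c X.
  rewrite -ltnS; apply: leq_trans ltY _; rewrite -cardD.
  apply: leq_trans (subset_leq_card (subsetIl _ _)) _.
  by rewrite cardsU1 xD.
have nYX : Y != X by apply: contraNneq xX => <-.
(* The set witnessing that [X] is essential has more than [c X >= c Y] points in [X], hence in [Y],
   and so breaks the bound at [Y] too. *)
have [I [_ ltI /(_ Y AY nYX)]] := canonical_essential canA AX.
rewrite leqNgt => /negP[]; apply: leq_ltn_trans leYX _.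
by apply: leq_trans ltI _; rewrite subset_leq_card // setIS.
Qed.

(** The witness of essentiality overfills [X] only. Its trace on [X] is dependent, and a circuit
    inside that trace respects all other members, so it must overfill [X]. *)
Lemma canonical_circuit X :
  canonical_loopless M E A c -> X \in A ->
  exists2 C, circuit M C & c X < #|C :&: X|.
Proof.
move=> canA AX; have [I [sI ltI cI]] := canonical_essential canA AX.
have /presentationP[gM lamA iM] : presentation M E A c.
  by case/canonical_looplessP: canA.
have nFI : I :&: X \notin indep M.
  rewrite iM; apply: contraL ltI => /laminar_indepP[_ /(_ X AX)].
  by rewrite -setIA setIid -leqNgt.
have sIM : I :&: X \subset ground M by rewrite gM (subset_trans (subsetIl _ _)).
have [|C cC sCI] := @minset_exists _
    [pred Z : {set T} | (Z \subset ground M) && (Z \notin indep M)] (I :&: X).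
  by rewrite /= sIM.
exists C => //; have /circuitP[sC nF _] := cC.
rewrite ltnNge; apply: contra nF => leX; rewrite iM.
apply/laminar_indepP; split=> [|Y AY]; first by rewrite -gM.
have [->//|nYX] := eqVneq Y X; apply: leq_trans (cI Y AY nYX).
by rewrite subset_leq_card // setSI // (subset_trans sCI) // subsetIl.
Qed.

Lemma canonical_loopless_cl_circuits :
  loopless M -> canonical_loopless M E A c ->
  A = [set cl M C | C in [set C : {set T} | circuit M C]] /\
  (forall C, circuit M C -> c (cl M C) = rank M C /\ rank M C = #|C|.-1).
Proof.
move=> llM canA; have presA : presentation M E A c.
  by case/canonical_looplessP: canA.
have [gM lamA iM] := presentationP.1 presA.
(* Being dependent, a circuit overfills some member, and that member is then its closure. *)
have over C : circuit M C -> exists2 X, X \in A & c X < #|C :&: X|.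
  case/circuitP=> sC nF _; apply/exists_inP; apply: contraR nF => /exists_inPn nX.
  rewrite iM; apply/laminar_indepP; split=> [|X /nX]; first by rewrite -gM.
  by rewrite -leqNgt.
split.
  apply/setP => X; apply/idP/imsetP => [AX|[C]].
    have [C cC ltX] := canonical_circuit canA AX.
    by exists C; rewrite ?inE // (canonical_cl_circuit llM canA AX cC ltX).
  rewrite inE => cC ->; have [Y AY ltY] := over C cC.
  by rewrite (canonical_cl_circuit llM canA AY cC ltY).
move=> C cC; rewrite (rank_circuit cC); split=> //.
have [X AX ltX] := over C cC; rewrite (canonical_cl_circuit llM canA AX cC ltX).
by have [_ ->] := circuit_overfull presA AX cC ltX.
Qed.

End LaminarPresentation.

(** * Rank capacities and the existence of presentations *)

Lemma presentation_rank (T : finType) (M : matroid T) E A c :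
  presentation M E A c -> presentation M E A (rank M).
Proof.
move=> /presentationP[gM lamA iM]; apply/presentationP; split=> //.
apply/setP => I; apply/idP/laminar_indepP => [FI|[sI cI]].
  split=> [|X _]; first by rewrite -gM indep_ground.
  by rewrite leq_rank ?subsetIr // (indepS FI) // subsetIl.
(* The rank of a member never exceeds its capacity, so the rank bounds imply the original ones. *)
rewrite iM; apply/laminar_indepP; split=> // X AX; apply: leq_trans (cI X AX) _.
apply/rank_leqP => J; rewrite iM => /laminar_indepP[_ /(_ X AX)] + sJX.
by rewrite (setIidPl sJX).
Qed.

Lemma is_laminar_presentation (T : finType) (M : matroid T) :
  is_laminar M -> exists A, presentation M (ground M) A (rank M).
Proof.
case=> T' [E [A [c [lamA [f [injf imf indf]]]]]]; rewrite /= in imf indf.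
(* The map [f] is controlled only on [ground M], so preimages are cut down to it. *)
pose pre (Z : {set T'}) := ground M :&: f @^-1: Z.
have [sAE /forall_inP lam] := andP lamA.
have sE Z : Z \in A -> Z \subset E by move=> /(subsetP sAE); rewrite inE.
have preK Z : Z \in A -> f @: pre Z = Z.
  move=> AZ; apply/setP => z; apply/imsetP/idP => [[x]|zZ].
    by rewrite !inE => /andP[_ ?] ->.
  have := subsetP (sE Z AZ) z zZ; rewrite -imf => /imsetP[x gx ex].
  by exists x; rewrite // !inE gx -ex.
(* By [preK], the capacity [c (f @: X)] at [X = pre Z] is the original [c Z]. *)
exists [set pre Z | Z in A]; apply: (@presentation_rank _ _ _ _ (fun X => c (f @: X))).
apply/presentationP; split=> //.
  apply/andP; split.
    by apply/subsetP => _ /imsetP[Z _ ->]; rewrite inE subsetIl.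
  apply/forall_inP => _ /imsetP[Y AY ->]; apply/forall_inP => _ /imsetP[Z AZ ->].
  apply/implyP => /set0Pn[x]; rewrite !inE => /andP[/andP[_ xY] /andP[_ xZ]].
  have /forall_inP/(_ Z AZ)/implyP := lam Y AY.
  case/(_ _)/orP => [|s|s]; first by apply/set0Pn; exists (f x); rewrite inE xY.
  - by rewrite setIS ?preimsetS.
  - by rewrite orbC setIS ?preimsetS.
have cardI (I : {set T}) Z : I \subset ground M -> #|I :&: pre Z| = #|f @: I :&: Z|.
  move=> sI; rewrite -(@card_in_imset _ _ f); last first.
    move=> x y /setIP[xI _] /setIP[yI _]; apply: injf; exact: (subsetP sI).
  congr #|pred_of_set _|; apply/setP => z; rewrite inE; apply/imsetP/andP.
    by case=> x; rewrite !inE => /and3P[xI _ xZ] ->; rewrite imset_f.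
  case=> /imsetP[x xI ->] xZ; exists x => //.
  by rewrite !inE xI xZ (subsetP sI).
apply/setP => I; apply/idP/laminar_indepP => [FI|[sI cI]].
  have sI := indep_ground FI; move: FI; rewrite indf // => /laminar_indepP[_ cI].
  split=> // _ /imsetP[Z AZ ->]; rewrite cardI // preK //; exact: cI.
rewrite indf //; apply/laminar_indepP; split; first by rewrite -imf imsetS.
by move=> Z AZ; rewrite -cardI // -{2}(preK Z) // cI ?imset_f.
Qed.

(** Distinct members may become equal after removing [D], so arbitrary capacities would not transfer
    unambiguously. The rank depends on the set alone, and [rank M (X :\: D) <= rank M X] recovers
    the old bounds. *)
Lemma presentation_delete (T : finType) (M : matroid T) A (D : {set T}) :
  presentation M (ground M) A (rank M) ->
  presentation (delete M D) (ground M :\: D) [set X :\: D | X in A] (rank M).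
Proof.
move=> /presentationP[_ /andP[/subsetP sAE /forall_inP lam] iM].
apply/presentationP; split=> //.
  apply/andP; split.
    apply/subsetP => _ /imsetP[Z AZ ->]; rewrite inE setSD //.
    by have := sAE Z AZ; rewrite inE.
  apply/forall_inP => _ /imsetP[Y AY ->]; apply/forall_inP => _ /imsetP[Z AZ ->].
  apply/implyP => /set0Pn[x]; rewrite !inE => /andP[/andP[_ xY] /andP[_ xZ]].
  have /forall_inP/(_ Z AZ)/implyP := lam Y AY.
  case/(_ _)/orP => [|s|s]; first by apply/set0Pn; exists x; rewrite inE xY.
  - by rewrite setSD.
  - by rewrite orbC setSD.
apply/setP => I; rewrite inE; apply/andP/laminar_indepP => -[].
  move=> FI sI; split=> // X _.
  by rewrite leq_rank ?subsetIr // (indepS FI) // subsetIl.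
move=> sI cI; split=> //; rewrite iM; apply/laminar_indepP; split.
  by rewrite (subset_trans sI) // subsetDl.
move=> X AX; have -> : I :&: X = I :&: (X :\: D).
  apply/setP => x; rewrite !inE; case xI: (x \in I) => //=.
  by have := subsetP sI x xI; rewrite inE => /andP[->].
apply: leq_trans (rankS M (subsetDl X D)); apply: cI.
exact: (imset_f (fun Z => Z :\: D)).
Qed.

Lemma canonical_loopless_exists (T : finType) (M : matroid T) E A c :
  presentation M E A c -> exists A', canonical_loopless M E A' c.
Proof.
move=> /presentationP[gM lamA iM].
pose P := [pred B : {set {set T}} | laminar E B && (laminar_indep E B c == indep M)].
have [|A' /minsetP[/= /andP[lamA' /eqP iA'] minA'] _] := @minset_exists _ P A.
  by rewrite /= lamA iM eqxx.
exists A'; apply/canonical_looplessP; split; first exact/presentationP.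
move=> X AX; apply/negP => eF; have /setP/(_ X) : A' :\ X = A'.
  by apply: minA'; rewrite ?subD1set //= laminarD1.
by rewrite !inE eqxx AX.
Qed.

(** * Restoring the loops *)

Section Loops.

Variables (T : finType) (M : matroid T) (A' : {set {set T}}).
Let A0 := cl M set0.

(** [A0] has rank 0, so its bound forces independent sets to avoid the loops; [A0] is disjoint from
    the members of [A'], so laminarity survives. *)
Lemma presentation_add_loops :
  presentation (delete M A0) (ground M :\: A0) A' (rank M) ->
  presentation M (ground M) (A0 |: A') (rank M).
Proof.
move=> /presentationP[_ /andP[/subsetP sAE /forall_inP lam] /setP iM].
have sD X : X \in A' -> X \subset ground M :\: A0 by move/sAE; rewrite inE.
have dis X : X \in A' -> A0 :&: X = set0.
  by move=> /sD; rewrite subsetD => /andP[_]; rewrite disjoint_sym => /disjoint_setI0.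
apply/presentationP; split=> //.
  apply/andP; split.
    apply/subsetP => X; rewrite !inE => /orP[/eqP->|/sD sX].
      by apply/subsetP => x; rewrite inE => /andP[].
    by rewrite (subset_trans sX) // subsetDl.
  apply/forall_inP => X /setU1P[->|AX]; apply/forall_inP => Y /setU1P[->|AY].
  - by rewrite subxx implybT.
  - by rewrite dis // eqxx.
  - by rewrite setIC dis // eqxx.
  - by have /forall_inP/(_ Y AY) := lam X AX.
apply/setP => I; apply/idP/laminar_indepP => [FI|[sI cI]].
  split=> [|X _]; first exact: indep_ground.
  by rewrite leq_rank ?subsetIr // (indepS FI) // subsetIl.
have sID : I \subset ground M :\: A0.
  rewrite subsetD sI -setI_eq0 -cards_eq0 -leqn0 -(rank_cl0 M).
  by rewrite cI // setU11.
have := iM I; rewrite inE sID andbT => ->; apply/laminar_indepP; split=> // X AX.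
by rewrite cI // setU1r.
Qed.

(** The singleton of a loop must overfill some member. Members of [A'] contain no loop, so this
    member is [A0], with capacity below 1. *)
Lemma presentation_cl0_capacity E c :
  ~~ loopless M -> presentation M E (A0 |: A') c ->
  A' \subset powerset (E :\: A0) -> c A0 = 0.
Proof.
move=> /forallPn[x]; rewrite negbK loop_cl0 => xA0.
move=> /presentationP[gM _ iM] /subsetP sA'.
have := xA0; rewrite mem_cl0 => /andP[gx]; rewrite iM => nFx.
have [X AX ltX] : exists2 X, X \in A0 |: A' & c X < #|[set x] :&: X|.
  apply/exists_inP; apply: contraR nFx => /exists_inPn nX.
  by apply/laminar_indepP; split=> [|X /nX]; rewrite ?sub1set -?gM -?leqNgt.
case/setU1P: AX ltX => [->|AX].
  move=> ltA0; apply/eqP; rewrite -leqn0 -ltnS; apply: leq_trans ltA0 _.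
  by rewrite -(cards1 x) subset_leq_card // subsetIl.
suff -> : [set x] :&: X = set0 by rewrite cards0.
apply/setP => y; rewrite !inE; case: eqP => //= ->.
have := sA' X AX; rewrite inE subsetD => /andP[_ /pred0P/(_ x)] /=.
by rewrite xA0 andbT.
Qed.

End Loops.

(** * Existence and uniqueness of the canonical presentation *)

Lemma canonical_ground (T : finType) (M : matroid T) E A c :
  canonical M E A c -> E = ground M.
Proof.
rewrite /canonical; case: (loopless M) => [/canonical_looplessP[]|[]];
  by move=> /presentationP[].
Qed.

Lemma canonical_exists (T : finType) (M : matroid T) :
  is_laminar M -> exists A, canonical M (ground M) A (rank M).
Proof.
move=> /is_laminar_presentation[A pA]; rewrite /canonical; case: (loopless M).
  exact: canonical_loopless_exists pA.
(* The capacities on the deletion are ranks in [M], so one function serves both the deletion and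
   [M], as [canonical] demands. *)
have [A' canA'] := canonical_loopless_exists (presentation_delete (cl M set0) pA).
exists (cl M set0 |: A'); split; last by exists A'.
by apply: presentation_add_loops; case/canonical_looplessP: canA'.
Qed.

Lemma canonical_loopless_unique (T : finType) (M : matroid T) E A c A' c' :
  loopless M -> canonical_loopless M E A c -> canonical_loopless M E A' c' ->
  A' = A /\ forall X, X \in A -> c' X = c X.
Proof.
move=> ll /(canonical_loopless_cl_circuits ll)[-> cA].
move=> /(canonical_loopless_cl_circuits ll)[-> cA']; split=> // X.
by case/imsetP=> C; rewrite inE => cC ->; rewrite (cA C cC).1 (cA' C cC).1.
Qed.

Lemma canonical_unique (T : finType) (M : matroid T) E A c E' A' c' :
  canonical M E A c -> canonical M E' A' c' ->
  [/\ E' = E, A' = A & forall X, X \in A -> c' X = c X].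
Proof.
move=> can can'; have eE := canonical_ground can; have eE' := canonical_ground can'.
subst E E'; move: can can'; rewrite /canonical; case: ifPn => ll.
  by move=> can /(canonical_loopless_unique ll can)[].
move=> [pA [B [eA canB]]] [pA' [B' [eA' canB']]]; subst A A'.
have sub D d : canonical_loopless (delete M (cl M set0)) (ground M :\: cl M set0) D d ->
    D \subset powerset (ground M :\: cl M set0).
  by move=> /canonical_looplessP[/presentationP[_ /andP[]]].
(* The deletion says nothing about the capacity at [cl M set0]; the presentation of [M] itself
   forces it to be 0 on both sides. *)
have c0 := presentation_cl0_capacity ll pA (sub _ _ canB).
have c'0 := presentation_cl0_capacity ll pA' (sub _ _ canB').
have [-> ec] := canonical_loopless_unique (delete_cl0_loopless M) canB canB'.
by split=> // X /setU1P[->|/ec //]; rewrite c0 c'0.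
Qed.

Theorem theorem2p7 (T : finType) (M : matroid T) (lamM : is_laminar M) :
  (exists (E : {set T}) (A : {set {set T}}) (c : {set T} -> nat),
     canonical M E A c /\
     (forall (E' : {set T}) (A' : {set {set T}}) (c' : {set T} -> nat),
        canonical M E' A' c' ->
        [/\ E' = E, A' = A & forall X, X \in A -> c' X = c X])) /\
  (loopless M ->
     forall (E : {set T}) (A : {set {set T}}) (c : {set T} -> nat),
       canonical M E A c ->
       A = [set cl M C | C in [set C : {set T} | circuit M C]] /\
       (forall C : {set T}, circuit M C ->
          c (cl M C) = rank M C /\ rank M C = #|C|.-1)).
Proof.
split=> [|ll E A c].
  have [A canA] := canonical_exists lamM.
  by exists (ground M), A, (rank M); split=> // E' A' c'; exact: canonical_unique.
rewrite /canonical ll; exact: canonical_loopless_cl_circuits.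
Qed.
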